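(* There is an absolute constant $C>0$ such that for every $\varepsilon>0$, every $n$, every $f\colon\{0,1\}^n\times\{0,1\}^n\to\{0,1\}$ and every distribution $\mu$ on $\{0,1\}^n\times\{0,1\}^n$, \[ \mathrm{IC}^{\mathrm{external}}_{\mu}[f,\varepsilon]\le\frac{C}{\varepsilon^2}\Big(\lim_{q\to\infty}\frac1q\mathrm{CC}_{\mu^q}[f^q,0]\Big)^2 . \]
   Context: Protocols are two-party randomized communication protocols (Alice holds $x$, Bob holds $y$; output is a function of the transcript). For $q\in\mathbb{N}$, $f^q$ maps $((x_1,\dots,x_q),(y_1,\dots,y_q))$ to $(f(x_1,y_1),\dots,f(x_q,y_q))$ and $\mu^q$ is the product distribution. $\mathrm{CC}_{\nu}[g,0]$ is the infimum, over protocols that output $g(x,y)$ correctly with probability $1$ on every input (including those outside the support of $\nu$), of the expected number of bits communicated when $(x,y)\sim\nu$. With $(X,Y)\sim\mu$, the external information of a protocol is $I(\Pi(X,Y);X,Y)$, and $\mathrm{IC}^{\mathrm{external}}_\mu[f,\varepsilon]$ is its infimum over protocols with $\Pr_{(x,y)\sim\mu}[\mathrm{output}(\Pi(x,y))\ne f(x,y)]\le\varepsilon$. *)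

(* Defs.v *)
From HB Require Import structures.
From mathcomp Require Import all_boot all_order all_algebra.
From mathcomp Require Import all_classical all_reals all_analysis.
From mathcomp Require Import Rstruct Rstruct_topology.
Set Implicit Arguments. Unset Strict Implicit. Unset Printing Implicit Defensive.
Import Order.TTheory GRing.Theory Num.Theory.
Local Open Scope ring_scope.
Local Open Scope classical_set_scope.

Notation Rl := Rdefinitions.R.

(* A two-party randomized protocol, as a finite binary protocol tree.
   - PAlice a p0 p1 : Alice sends one bit, equal to 1 with probability [a x]
     (private randomness; depends only on her input x and the history);
   - PBob b p0 p1 : likewise for Bob with input y;
   - PPublic c p0 p1 : a public coin, equal to 1 with probability c
     (visible to both players, part of the transcript, not counted as
     communication);
   - PLeaf o : the protocol ends with output o (a function of the transcript). *)
Section Protocols.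
Variables (X Y : Type) (O : eqType).

Inductive protocol :=
| PLeaf of O
| PAlice of (X -> Rl) & protocol & protocol
| PBob of (Y -> Rl) & protocol & protocol
| PPublic of Rl & protocol & protocol.

Fixpoint wf_protocol (p : protocol) : Prop :=
  match p with
  | PLeaf _ => True
  | PAlice a p0 p1 => (forall x, 0 <= a x <= 1) /\ wf_protocol p0 /\ wf_protocol p1
  | PBob b p0 p1 => (forall y, 0 <= b y <= 1) /\ wf_protocol p0 /\ wf_protocol p1
  | PPublic c p0 p1 => (0 <= c <= 1) /\ wf_protocol p0 /\ wf_protocol p1
  end.

Fixpoint leaves (p : protocol) : seq (seq bool) :=
  match p with
  | PLeaf _ => [:: [::]]
  | PAlice _ p0 p1 | PBob _ p0 p1 | PPublic _ p0 p1 =>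
      map (cons false) (leaves p0) ++ map (cons true) (leaves p1)
  end.

Definition bitprob (r : Rl) (b : bool) : Rl := if b then r else 1 - r.

Fixpoint tprob (p : protocol) (x : X) (y : Y) (t : seq bool) : Rl :=
  match p, t with
  | PLeaf _, [::] => 1
  | PAlice a p0 p1, b :: t' => bitprob (a x) b * tprob (if b then p1 else p0) x y t'
  | PBob bb p0 p1, b :: t' => bitprob (bb y) b * tprob (if b then p1 else p0) x y t'
  | PPublic c p0 p1, b :: t' => bitprob c b * tprob (if b then p1 else p0) x y t'
  | _, _ => 0
  end.

Fixpoint output (p : protocol) (t : seq bool) : option O :=
  match p, t with
  | PLeaf o, [::] => Some o
  | PAlice _ p0 p1, b :: t' | PBob _ p0 p1, b :: t' | PPublic _ p0 p1, b :: t' =>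
      output (if b then p1 else p0) t'
  | _, _ => None
  end.

Fixpoint cost (p : protocol) (t : seq bool) : nat :=
  match p, t with
  | PAlice _ p0 p1, b :: t' | PBob _ p0 p1, b :: t' => (cost (if b then p1 else p0) t').+1
  | PPublic _ p0 p1, b :: t' => cost (if b then p1 else p0) t'
  | _, _ => 0
  end.
End Protocols.

Section Measures.
Variables (X Y : finType) (O : eqType).

Definition is_distr (nu : X * Y -> Rl) : Prop :=
  (forall z, 0 <= nu z) /\ \sum_(z : X * Y) nu z = 1.

Definition exp_cost (p : protocol X Y O) (nu : X * Y -> Rl) : Rl :=
  \sum_(z : X * Y) nu z *
    \sum_(t <- leaves p) tprob p z.1 z.2 t * (cost p t)%:R.

Definition zero_error (p : protocol X Y O) (g : X -> Y -> O) : Prop :=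
  forall x y, \sum_(t <- leaves p | output p t == Some (g x y)) tprob p x y t = 1.

Definition CC0 (nu : X * Y -> Rl) (g : X -> Y -> O) : Rl :=
  inf [set c | exists p : protocol X Y O,
                 [/\ wf_protocol p, zero_error p g & c = exp_cost p nu]].

Definition err (p : protocol X Y O) (nu : X * Y -> Rl) (g : X -> Y -> O) : Rl :=
  \sum_(z : X * Y) nu z *
    \sum_(t <- leaves p | output p t != Some (g z.1 z.2)) tprob p z.1 z.2 t.

Definition ptrans (p : protocol X Y O) (nu : X * Y -> Rl) (t : seq bool) : Rl :=
  \sum_(z : X * Y) nu z * tprob p z.1 z.2 t.

(* external information I(Pi(X,Y); X,Y) in bits, (X,Y) ~ nu *)
Definition ext_info (p : protocol X Y O) (nu : X * Y -> Rl) : Rl :=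
  \sum_(z : X * Y) \sum_(t <- leaves p)
     (let j := nu z * tprob p z.1 z.2 t in
      if 0 < j then j * (ln (tprob p z.1 z.2 t / ptrans p nu t) / ln 2) else 0).

Definition IC_ext (nu : X * Y -> Rl) (g : X -> Y -> O) (eps : Rl) : Rl :=
  inf [set i | exists p : protocol X Y O,
                 [/\ wf_protocol p, err p nu g <= eps & i = ext_info p nu]].

Definition tensor_fun (f : X -> Y -> O) (q : nat) :
  q.-tuple X -> q.-tuple Y -> q.-tuple O :=
  fun xs ys => [tuple f (tnth xs i) (tnth ys i) | i < q].

Definition prod_distr (nu : X * Y -> Rl) (q : nat) :
  q.-tuple X * q.-tuple Y -> Rl :=
  fun z => \prod_(i < q) nu (tnth z.1 i, tnth z.2 i).
End Measures.

Arguments tensor_fun {X Y O} f q.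
Arguments prod_distr {X Y} nu q.

(* Main.v *)
Require Import Defs.
From HB Require Import structures.
From mathcomp Require Import all_boot all_order all_algebra.
From mathcomp Require Import all_classical all_reals all_analysis.
From mathcomp Require Import Rstruct Rstruct_topology zify ring lra.
Set Implicit Arguments. Unset Strict Implicit. Unset Printing Implicit Defensive.
Import Order.TTheory GRing.Theory Num.Theory.
Local Open Scope ring_scope.

(** Let l be the limit of CC0(f^q)/q, which exists because CC0(f^q) is
    subadditive in q.

    Lower bounds on l come from weights w > 0 on inputs such that every
    f-monochromatic rectangle has mass at most 1 under mu * w.  A monochromatic
    rectangle of f^q lies in a product of f-monochromatic rectangles, so the
    q-fold product of w has the same property for f^q; Kraft's inequality for
    the leaf rectangles of a zero-error protocol, together with ln x <= x - 1,
    then gives E[ln w] <= l ln 2.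

    If one of the two values of f has mass at most eps, a constant protocol
    works.  Otherwise w = 1 / Pr[f = f(z)] gives eps <= l ln 2 and
    eps ln(1/eps) <= 2 l ln 2.  Choose k monochromatic rectangles greedily, so
    that no monochromatic rectangle has uncovered mass more than 1/k.  If more
    than eps remained uncovered, the weight equal to 1 - eps on covered inputs
    and to k eps on the others would give eps ln k <= 5 l ln 2.  Hence some
    k = 2^m with m = O(l/eps) monochromatic rectangles cover all but eps of the
    mass, and the protocol of Aho, Ullman and Yannakakis for such a cover has
    2^O(m^2) leaves, so it reveals at most O(m^2) bits. *)

(** * Expectations over the transcripts of a protocol *)

Section Expectation.
Context {X Y : Type} {O : eqType}.
Implicit Types (p : protocol X Y O) (phi psi : O -> nat -> Rl).

(** The expectation of [phi] at the output and the number of bits sent. Bits are counted by shifting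
    the argument of [phi], so that cost, error and Kraft sums are all handled by induction on the
    tree. A public coin leaves the count unchanged. *)
Fixpoint ev p (x : X) (y : Y) phi : Rl :=
  match p with
  | PLeaf o => phi o 0%N
  | PAlice a p0 p1 =>
      (1 - a x) * ev p0 x y (fun o c => phi o c.+1) +
      a x * ev p1 x y (fun o c => phi o c.+1)
  | PBob b p0 p1 =>
      (1 - b y) * ev p0 x y (fun o c => phi o c.+1) +
      b y * ev p1 x y (fun o c => phi o c.+1)
  | PPublic r p0 p1 => (1 - r) * ev p0 x y phi + r * ev p1 x y phi
  end.

Lemma sum_leavesE p x y (psi : option O -> nat -> Rl) :
  \sum_(t <- leaves p) tprob p x y t * psi (output p t) (cost p t) =
  ev p x y (fun o c => psi (Some o) c).
Proof.
elim: p psi => [ou|a p0 IH0 p1 IH1|b p0 IH0 p1 IH1|r p0 IH0 p1 IH1] psi /=;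
  first (by rewrite big_seq1 mul1r);
  rewrite big_cat !big_map /= -(IH0 (fun o c => psi o _)) -(IH1 (fun o c => psi o _)) !mulr_sumr;
  by congr (_ + _); apply: eq_bigr => t _; rewrite mulrA.
Qed.

Lemma eq_ev p x y phi psi : phi =2 psi -> ev p x y phi = ev p x y psi.
Proof.
elim: p phi psi => [ou|a p0 IH0 p1 IH1|b p0 IH0 p1 IH1|r p0 IH0 p1 IH1] phi psi e /=;
  first (exact: e);
  by congr (_ * _ + _ * _); [apply: IH0 | apply: IH1] => o c; exact: e.
Qed.

Lemma ev_cst p x y k : ev p x y (fun _ _ => k) = k.
Proof.
by elim: p => [ou|a p0 IH0 p1 IH1|b p0 IH0 p1 IH1|r p0 IH0 p1 IH1] //=;
  rewrite IH0 IH1; ring.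
Qed.

Lemma ev_linear p x y k phi psi :
  ev p x y (fun o c => k * phi o c + psi o c) = k * ev p x y phi + ev p x y psi.
Proof.
elim: p phi psi => [ou|a p0 IH0 p1 IH1|b p0 IH0 p1 IH1|r p0 IH0 p1 IH1] phi psi //=;
 rewrite (IH0 (fun o c => phi o _) (fun o c => psi o _))
         (IH1 (fun o c => phi o _) (fun o c => psi o _)); ring.
Qed.

Lemma evZ p x y k phi : ev p x y (fun o c => k * phi o c) = k * ev p x y phi.
Proof.
rewrite -[RHS]addr0 -(ev_cst p x y 0) -ev_linear.
by apply: eq_ev => o c; rewrite addr0.
Qed.

Lemma ev_le p x y phi psi : wf_protocol p ->
  (forall o c, phi o c <= psi o c) -> ev p x y phi <= ev p x y psi.
Proof.
elim: p phi psi => [ou|a p0 IH0 p1 IH1|b p0 IH0 p1 IH1|r p0 IH0 p1 IH1] phi psi //=;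
  move=> [h [h0 h1]] le_pp; rewrite lerD // ler_wpM2l ?IH0 ?IH1 ?subr_ge0 //;
  (by case/andP: h) || (by case/andP: (h x)) || (by case/andP: (h y)).
Qed.

Lemma ev_ge0 p x y phi : wf_protocol p ->
  (forall o c, 0 <= phi o c) -> 0 <= ev p x y phi.
Proof. by move=> wp h; rewrite -(ev_cst p x y 0) ev_le. Qed.
End Expectation.

(** Success and error probabilities add up to 1. Unlike a success probability equal to 1, a
    vanishing error is easily passed down to subprotocols. *)
Lemma zero_errorP (X Y : finType) (O : eqType) (p : protocol X Y O) (g : X -> Y -> O) :
  (forall x y, ev p x y (fun o _ => (o != g x y)%:R) = 0) <-> zero_error p g.
Proof.
have e x y : \sum_(t <- leaves p | output p t == Some (g x y)) tprob p x y t =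
             1 - ev p x y (fun o _ => (o != g x y)%:R).
  rewrite big_mkcond /=.
  under eq_bigr => t _ do rewrite -mulrb -mulr_natr.
  rewrite (sum_leavesE p x y (fun o _ => (o == Some (g x y))%:R)).
  rewrite -[X in X - _](ev_cst p x y 1) addrC -mulN1r -ev_linear.
  by apply: eq_ev => o c; rewrite (inj_eq Some_inj); case: (o == _) => /=; ring.
split=> h x y; first by rewrite e h subr0.
by have := h x y; rewrite e; lra.
Qed.

Lemma exp_costE (X Y : finType) (O : eqType) (p : protocol X Y O) nu :
  exp_cost p nu = \sum_z nu z * ev p z.1 z.2 (fun _ c => c%:R).
Proof.
by apply: eq_bigr => z _; rewrite (sum_leavesE p z.1 z.2 (fun _ c => c%:R)).
Qed.

(** * External information and the number of leaves *)

Lemma tprob_itv (X Y : Type) (O : eqType) (p : protocol X Y O) x y t :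
  wf_protocol p -> 0 <= tprob p x y t <= 1.
Proof.
have bp r b : 0 <= r <= 1 -> 0 <= bitprob r b <= 1 by case: b => //=; lra.
have mul01 (u v : Rl) : 0 <= u <= 1 -> 0 <= v <= 1 -> 0 <= u * v <= 1.
  by move=> /andP[? ?] /andP[? ?]; rewrite mulr_ge0 //= mulr_ile1.
elim: p t => [ou|a p0 IH0 p1 IH1|b p0 IH0 p1 IH1|r p0 IH0 p1 IH1] [|s t] //=;
  rewrite ?lexx ?ler01 // => -[h [h0 h1]]; apply: mul01;
  by [apply: bp | case: s; [apply: IH1 | apply: IH0]].
Qed.

Lemma sum_tprob (X Y : Type) (O : eqType) (p : protocol X Y O) x y :
  \sum_(t <- leaves p) tprob p x y t = 1.
Proof.
rewrite -(ev_cst p x y 1) -(sum_leavesE p x y (fun _ _ => 1)).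
by apply: eq_bigr => t _; rewrite mulr1.
Qed.

Lemma ln_le_subr1 (R : realType) (x : R) : 0 < x -> ln x <= x - 1.
Proof.
move=> x0; rewrite -[leRHS]expRK ler_ln ?posrE ?expR_gt0 //.
by rewrite (le_trans _ (expR_ge1Dx _)) // addrC subrK.
Qed.

Lemma size_leaves_gt0 (X Y : Type) (O : eqType) (p : protocol X Y O) :
  (0 < size (leaves p))%N.
Proof.
by elim: p => [ou|a p0 IH0 p1 _|b p0 IH0 p1 _|r p0 IH0 p1 _] //=;
  rewrite size_cat !size_map addn_gt0 IH0.
Qed.

(** Information is at most the entropy of the transcript, hence at most the logarithm of the number
    [N] of leaves. With [P] the probability of a transcript, [tprob <= 1] and [ln x <= x - 1] bound
    each logarithm by [ln N - 1 + 1 / (P N)]; on average the last term is at most 1. *)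
Lemma ext_info_le_leaves (X Y : finType) (O : eqType) (p : protocol X Y O) nu :
  wf_protocol p -> is_distr nu ->
  ext_info p nu <= ln (size (leaves p))%:R / ln 2.
Proof.
move=> wp [nu0 nu1].
have ln2 : 0 < ln 2 :> Rl by rewrite ln_gt0 // ltr1n.
have t0 x y t : 0 <= tprob p x y t by case/andP: (tprob_itv x y t wp).
have t1 x y t : tprob p x y t <= 1 by case/andP: (tprob_itv x y t wp).
have N0 : 0 < (size (leaves p))%:R :> Rl by rewrite ltr0n size_leaves_gt0.
set N : Rl := (size (leaves p))%:R in N0 *.
pose j z t := nu z * tprob p z.1 z.2 t.
have j0 z t : 0 <= j z t by rewrite mulr_ge0.
have jP z t : j z t <= ptrans p nu t.
  by rewrite /ptrans (bigD1 z) //= lerDl sumr_ge0 // => z' _; exact: j0.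
rewrite ler_pdivlMr // mulr_suml.
have step z t : (if 0 < j z t then j z t * (ln (tprob p z.1 z.2 t / ptrans p nu t) / ln 2) else 0)
    * ln 2 <= j z t * (ln N - 1) + j z t / ptrans p nu t / N.
  case: ifPn => [jp|]; last first.
    rewrite -leNgt => jn; have -> : j z t = 0 by apply/le_anti; rewrite jn j0.
    by rewrite !mul0r addr0.
  have P0 := lt_le_trans jp (jP z t).
  have tp : 0 < tprob p z.1 z.2 t.
    by rewrite lt_neqAle t0 andbT eq_sym; apply: contraTneq jp => e; rewrite /j e mulr0 ltxx.
  rewrite -[X in X <= _]mulrA divfK ?gt_eqF // -[X in _ + X]mulrA -mulrDr ler_pM2l //.
  have le1 : ln (tprob p z.1 z.2 t / ptrans p nu t) <= ln (N * ((ptrans p nu t)^-1 * N^-1)).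
    rewrite ler_ln ?posrE ?mulr_gt0 ?invr_gt0 //.
    by rewrite mulrCA mulfV ?gt_eqF // mulr1 -[leRHS]mul1r ler_wpM2r // invr_ge0 ltW.
  apply: (le_trans le1); rewrite lnM ?posrE ?mulr_gt0 ?invr_gt0 // -addrA lerD2l addrC.
  by rewrite ln_le_subr1 // mulr_gt0 ?invr_gt0.
apply: le_trans (_ : \sum_z \sum_(t <- leaves p) (j z t * (ln N - 1) + j z t / ptrans p nu t / N) <= _).
  by apply: ler_sum => z _; rewrite mulr_suml; apply: ler_sum => t _; exact: step.
under eq_bigr do rewrite big_split /=.
rewrite big_split /=.
have -> : \sum_z \sum_(t <- leaves p) j z t * (ln N - 1) = ln N - 1.
  rewrite -[RHS]mul1r -nu1 mulr_suml; apply: eq_bigr => z _.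
  by rewrite -mulr_suml -mulr_sumr sum_tprob mulr1.
suff : \sum_z \sum_(t <- leaves p) j z t / ptrans p nu t / N <= 1 by lra.
rewrite exchange_big /=.
apply: le_trans (_ : \sum_(t <- leaves p) N^-1 <= _); last first.
  by rewrite big_const_seq count_predT iter_addr_0 -mulr_natr mulVf ?gt_eqF.
apply: ler_sum => t _; rewrite -!mulr_suml -[leRHS]mul1r ler_wpM2r ?invr_ge0 ?(ltW N0) //.
(* A leaf of probability 0 contributes 0, because its numerator vanishes. *)
rewrite -/(ptrans p nu t); case: (eqVneq (ptrans p nu t) 0) => [->|?].
  by rewrite mul0r.
by rewrite divff.
Qed.

(** * Monochromatic rectangles and Kraft's inequality *)

Definition mono (X Y : finType) (O : eqType) (g : X -> Y -> O) (A : {set X}) (B : {set Y}) : Prop :=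
  exists v, forall x y, x \in A -> y \in B -> g x y = v.

Definition rect (X Y : finType) (A : {set X}) (B : {set Y}) (z : X * Y) : bool :=
  (z.1 \in A) && (z.2 \in B).

(** Feasibility in the dual of the linear program for fractional covers by monochromatic
    rectangles. *)
Definition mono_mass_le1 (X Y : finType) (O : eqType) (g : X -> Y -> O) (m : X * Y -> Rl) : Prop :=
  (forall z, 0 <= m z) /\
  forall A B, mono g A B -> \sum_(z | rect A B z) m z <= 1.

Section LowerBound.
Context {X Y : finType} {O : eqType} (g : X -> Y -> O).
Implicit Types (p : protocol X Y O).

(** Induction step of Kraft's inequality where a player speaks. [D0] and [D1] contain the inputs
    that can reach each child, and may overlap because the bit is random. The coefficients [1 - r]
    and [r] are at most 1, so each child contributes at most one half. *)
Lemma kraft_node (D D0 D1 : pred (X * Y)) (r m e0 e1 : X * Y -> Rl) :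
  (forall z, 0 <= r z <= 1) -> (forall z, 0 <= m z) ->
  (forall z, 0 <= e0 z) -> (forall z, 0 <= e1 z) ->
  (forall z, D z -> r z < 1 -> D0 z) -> (forall z, D z -> 0 < r z -> D1 z) ->
  \sum_(z | D0 z) m z * e0 z <= 1 -> \sum_(z | D1 z) m z * e1 z <= 1 ->
  \sum_(z | D z) m z * ((1 - r z) * (2^-1 * e0 z) + r z * (2^-1 * e1 z)) <= 1.
Proof.
move=> r01 m0 e00 e10 D0P D1P S0 S1.
suff : \sum_(z | D z) m z * ((1 - r z) * (2^-1 * e0 z) + r z * (2^-1 * e1 z)) <=
  2^-1 * (\sum_(z | D0 z) m z * e0 z) + 2^-1 * (\sum_(z | D1 z) m z * e1 z) by lra.
rewrite !mulr_sumr (big_mkcond D) (big_mkcond D0) (big_mkcond D1) /= -big_split /=; apply: ler_sum => z _.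
have /andP[r0 r1] := r01 z.
have M0 := mulr_ge0 (m0 z) (e00 z); have M1 := mulr_ge0 (m0 z) (e10 z).
have B0 : 0 <= (if D0 z then 2^-1 * (m z * e0 z) else 0) by case: ifP => // _; lra.
have B1 : 0 <= (if D1 z then 2^-1 * (m z * e1 z) else 0) by case: ifP => // _; lra.
case: ifPn => [Dz|_]; last by rewrite addr_ge0.
rewrite mulrDr; apply: lerD.
  move: r1; rewrite le_eqVlt => /predU1P[->|lt]; first by rewrite subrr mul0r mulr0.
  by rewrite (D0P z Dz lt); nra.
move: r0; rewrite le_eqVlt => /predU1P[<-|lt]; first by rewrite mul0r mulr0.
by rewrite (D1P z Dz lt); nra.
Qed.

(* A subprotocol is only correct on the rectangle of inputs that can reach it,
   hence the induction over rectangles. *)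
Lemma kraft_rect p (m : X * Y -> Rl) (A : {set X}) (B : {set Y}) :
  wf_protocol p -> mono_mass_le1 g m ->
  (forall x y, x \in A -> y \in B -> ev p x y (fun o _ => (o != g x y)%:R) = 0) ->
  \sum_(z | rect A B z) m z * ev p z.1 z.2 (fun _ c => 2^-1 ^+ c) <= 1.
Proof.
move=> + [m0 mM].
have evS q x y : ev q x y (fun _ c => 2^-1 ^+ c.+1) = 2^-1 * ev q x y (fun _ c => 2^-1 ^+ c).
  by rewrite -evZ; apply: eq_ev => o c; rewrite exprS.
have ez (q : protocol X Y O) x y : wf_protocol q -> 0 <= ev q x y (fun o _ => (o != g x y)%:R).
  by move=> wq; apply: ev_ge0 => // *; exact: ler0n.
have ek (q : protocol X Y O) x y : wf_protocol q -> 0 <= ev q x y (fun _ c => 2^-1 ^+ c).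
  by move=> wq; apply: ev_ge0 => // *; rewrite exprn_ge0 // invr_ge0.
(* No error at a node means no error in any branch taken with positive probability. *)
have branch (r e0 e1 : Rl) : 0 <= r <= 1 -> 0 <= e0 -> 0 <= e1 -> (1 - r) * e0 + r * e1 = 0 ->
    (r < 1 -> e0 = 0) /\ (0 < r -> e1 = 0).
  move=> /andP[r0 r1] e00 e10 /eqP; rewrite paddr_eq0 ?mulr_ge0 ?subr_ge0 //.
  rewrite !mulf_eq0 subr_eq0 => /andP[/orP a /orP b]; split=> h.
    by case: a => /eqP // e; rewrite -e ltxx in h.
  by case: b => /eqP // e; rewrite e ltxx in h.
elim: p A B => [ou|a p0 IH0 p1 IH1|b p0 IH0 p1 IH1|r p0 IH0 p1 IH1] A B /=.
- move=> _ h; under eq_bigr do rewrite expr0 mulr1.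
  apply: mM; exists ou => x y xA yB.
  by have /eqP := h x y xA yB; rewrite pnatr_eq0 eqb0 negbK => /eqP.
- move=> [ab [w0 w1]] h.
  have hb x y xA yB := branch _ _ _ (ab x) (ez _ x y w0) (ez _ x y w1) (h x y xA yB).
  under eq_bigr do rewrite !evS.
  apply: (@kraft_node _ (rect [set x in A | a x < 1] B) (rect [set x in A | 0 < a x] B)
    (fun z => a z.1)) => //; try (by move=> z; exact: ek).
  + by move=> z /andP[zA zB] lt; rewrite /rect inE zA zB lt.
  + by move=> z /andP[zA zB] lt; rewrite /rect inE zA zB lt.
  + by apply: IH0 => // x y; rewrite inE => /andP[xA lt] yB; have [-> //] := hb x y xA yB.
  + by apply: IH1 => // x y; rewrite inE => /andP[xA lt] yB; have [_ -> //] := hb x y xA yB.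
- move=> [bb [w0 w1]] h.
  have hb x y xA yB := branch _ _ _ (bb y) (ez _ x y w0) (ez _ x y w1) (h x y xA yB).
  under eq_bigr do rewrite !evS.
  apply: (@kraft_node _ (rect A [set y in B | b y < 1]) (rect A [set y in B | 0 < b y])
    (fun z => b z.2)) => //; try (by move=> z; exact: ek).
  + by move=> z /andP[zA zB] lt; rewrite /rect inE zA zB lt.
  + by move=> z /andP[zA zB] lt; rewrite /rect inE zA zB lt.
  + by apply: IH0 => // x y xA; rewrite inE => /andP[yB lt]; have [-> //] := hb x y xA yB.
  + by apply: IH1 => // x y xA; rewrite inE => /andP[yB lt]; have [_ -> //] := hb x y xA yB.
- move=> [rb [w0 w1]] h.
  have hb x y xA yB := branch _ _ _ rb (ez _ x y w0) (ez _ x y w1) (h x y xA yB).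
  (* A public coin costs no bit and so gives no factor one half, but its bias is the same for all
     inputs: the sum is a convex combination of the sums of the children. A child of weight 0 may
     err, so the induction hypothesis is used only for positive weight. *)
  have -> : \sum_(z | rect A B z) m z * ((1 - r) * ev p0 z.1 z.2 (fun _ c => 2^-1 ^+ c) +
      r * ev p1 z.1 z.2 (fun _ c => 2^-1 ^+ c)) =
    (1 - r) * (\sum_(z | rect A B z) m z * ev p0 z.1 z.2 (fun _ c => 2^-1 ^+ c)) +
    r * (\sum_(z | rect A B z) m z * ev p1 z.1 z.2 (fun _ c => 2^-1 ^+ c)).
    by rewrite !mulr_sumr -big_split /=; apply: eq_bigr => z _; ring.
  set S0 := \sum_(z | _) m z * ev p0 _ _ _; set S1 := \sum_(z | _) m z * ev p1 _ _ _.
  have /andP[r0 r1] := rb.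
  have T0 : (1 - r) * S0 <= 1 - r.
    move: (r1); rewrite le_eqVlt => /predU1P[->|lt]; first by rewrite subrr mul0r.
    rewrite -[leRHS]mulr1 ler_wpM2l ?subr_ge0 //; apply: IH0 => // x y xA yB.
    by have [-> //] := hb x y xA yB.
  have T1 : r * S1 <= r.
    move: (r0); rewrite le_eqVlt => /predU1P[<-|lt]; first by rewrite mul0r.
    rewrite -[leRHS]mulr1 ler_wpM2l //; apply: IH1 => // x y xA yB.
    by have [_ -> //] := hb x y xA yB.
  by lra.
Qed.

(** Averaging [ln (w z * 2^-c) <= w z * 2^-c - 1] over inputs and transcripts of cost [c] gives a
    nonpositive right-hand side by Kraft's inequality, while the left-hand side averages
    [ln (w z) - c ln 2]. *)
Lemma exp_cost_ge p (nu w : X * Y -> Rl) :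
  wf_protocol p -> zero_error p g -> is_distr nu -> (forall z, 0 < w z) ->
  mono_mass_le1 g (fun z => nu z * w z) ->
  \sum_z nu z * ln (w z) <= ln 2 * exp_cost p nu.
Proof.
move=> wp /zero_errorP zp [nu0 nu1] w0 mm.
have K : \sum_z nu z * w z * ev p z.1 z.2 (fun _ c => 2^-1 ^+ c) <= 1.
  have := @kraft_rect p _ [set: X] [set: Y] wp mm (fun x y _ _ => zp x y).
  by under eq_bigl do rewrite /rect !inE.
suff : \sum_z nu z * ln (w z) <= \sum_z nu z * w z * ev p z.1 z.2 (fun _ c => 2^-1 ^+ c)
   - \sum_z nu z + ln 2 * exp_cost p nu by rewrite nu1; lra.
rewrite exp_costE mulr_sumr -sumrB -big_split /=; apply: ler_sum => z _.
have -> (k l e d : Rl) : nu z * k * e - nu z + l * (nu z * d) = nu z * (k * e - 1 + l * d) by ring.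
rewrite ler_wpM2l //.
have := ev_linear p z.1 z.2 (- ln 2) (fun _ c => c%:R) (fun _ _ => ln (w z)).
have := ev_linear p z.1 z.2 (w z) (fun _ c => 2^-1 ^+ c) (fun _ _ => - 1).
rewrite !ev_cst => e1 e2.
suff : ev p z.1 z.2 (fun _ c => - ln 2 * c%:R + ln (w z)) <=
       ev p z.1 z.2 (fun _ c => w z * 2^-1 ^+ c - 1) by rewrite e1 e2; lra.
apply: ev_le => // _ c.
have -> : - ln 2 * c%:R + ln (w z) = ln (w z * 2^-1 ^+ c).
  rewrite lnM ?posrE ?exprn_gt0 ?invr_gt0 // lnXn ?invr_gt0 // lnV ?posrE //.
  by rewrite -mulr_natr; ring.
by apply: ln_le_subr1; rewrite mulr_gt0 ?exprn_gt0 ?invr_gt0.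
Qed.
End LowerBound.

(** * The lower bound for tensor powers *)

Section Tensor.
Context {X Y : finType} {O : eqType}.

Lemma sum_tensor q (F : 'I_q -> X * Y -> Rl) :
  \sum_(z : q.-tuple X * q.-tuple Y) \prod_i F i (tnth z.1 i, tnth z.2 i) =
  \prod_i \sum_u F i u.
Proof.
rewrite bigA_distr_bigA.
pose h (f : {ffun 'I_q -> X * Y}) := ([tuple (f i).1 | i < q], [tuple (f i).2 | i < q]).
pose h' (z : q.-tuple X * q.-tuple Y) := [ffun i : 'I_q => (tnth z.1 i, tnth z.2 i)].
have hK : cancel h h'.
  by move=> f; apply/ffunP => i; rewrite ffunE !tnth_mktuple -surjective_pairing.
have h'K : cancel h' h.
  by move=> [x y]; congr pair; apply: eq_from_tnth => i; rewrite tnth_mktuple ffunE.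
rewrite (reindex h) /=; last by apply: onW_bij; exists h'.
by apply: eq_bigr => f _; apply: eq_bigr => i _; rewrite !tnth_mktuple -surjective_pairing.
Qed.

Lemma prod_distr_ge0 (m : X * Y -> Rl) q z : (forall u, 0 <= m u) -> 0 <= prod_distr m q z.
Proof. by move=> m0; apply: prodr_ge0. Qed.

Lemma is_distr_prod (mu : X * Y -> Rl) q : is_distr mu -> is_distr (prod_distr mu q).
Proof.
move=> [mu0 mu1]; split=> [z|]; first exact: prod_distr_ge0.
by rewrite (sum_tensor (fun _ => mu)) big1.
Qed.

(** Every row of [A] meets every column of [B] in the rectangle, so the [i]-th projections of [A]
    and [B] span a rectangle on which [f] is constantly [tnth v i]. The product of these rectangles
    contains the given one, and its mass factors. *)
Lemma mono_mass_tensor (f : X -> Y -> O) (m : X * Y -> Rl) q :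
  mono_mass_le1 f m -> mono_mass_le1 (tensor_fun f q) (prod_distr m q).
Proof.
move=> [m0 mM]; split=> [z|A B [v fv]]; first exact: prod_distr_ge0.
pose Ai i := [set tnth a i | a : q.-tuple X in A].
pose Bi i := [set tnth b i | b : q.-tuple Y in B].
pose F i u := if rect (Ai i) (Bi i) u then m u else 0.
have F0 i u : 0 <= F i u by rewrite /F; case: ifP.
apply: (@le_trans _ _ (\prod_i \sum_u F i u)).
  rewrite -sum_tensor big_mkcond; apply: ler_sum => -[a b] _.
  case: ifPn => [/andP[/= aA bB]|_]; last by apply: prodr_ge0.
  by apply: ler_prod => i _; rewrite m0 /F /rect /= (imset_f (fun a => tnth a i) aA)
    (imset_f (fun b => tnth b i) bB) /=.
apply: prodr_ile1 => i _; rewrite sumr_ge0 //= /F -big_mkcond.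
apply: mM; exists (tnth v i) => x y /imsetP[a aA ->] /imsetP[b bB ->].
by rewrite -(fv a b aA bB) tnth_mktuple.
Qed.

Lemma ln_prod (R : realType) (I : Type) (s : seq I) (F : I -> R) :
  (forall i, 0 < F i) -> ln (\prod_(i <- s) F i) = \sum_(i <- s) ln (F i).
Proof.
move=> F0; elim: s => [|i s IH]; first by rewrite !big_nil ln1.
by rewrite !big_cons lnM ?posrE ?prodr_gt0 // IH.
Qed.

Lemma sum_prod_distr_ln (mu w : X * Y -> Rl) q : is_distr mu -> (forall u, 0 < w u) ->
  \sum_z prod_distr mu q z * ln (prod_distr w q z) = q%:R * \sum_u mu u * ln (w u).
Proof.
move=> [_ mu1] w0; under eq_bigr do rewrite ln_prod // mulr_sumr.
rewrite exchange_big /= -[q in RHS]card_ord mulr_natl -sumr_const; apply: eq_bigr => j _.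
(* Written as a product over coordinates, the [j]-th summand falls under [sum_tensor]; every factor
   other than the [j]-th sums to 1. *)
pose F i u := mu u * (if i == j then ln (w u) else 1).
transitivity (\prod_i \sum_u F i u).
  rewrite -sum_tensor; apply: eq_bigr => z _; rewrite big_split /=; congr (_ * _).
  by rewrite (bigD1 j) //= eqxx big1 ?mulr1 // => i /negPf ->.
rewrite (bigD1 j) //= [X in _ * X]big1 => [|i /negPf ij].
  by rewrite mulr1; apply: eq_bigr => u _; rewrite /F eqxx.
by rewrite -[RHS]mu1; apply: eq_bigr => u _; rewrite /F ij mulr1.
Qed.

End Tensor.

(** Makes the set in [CC0] nonempty, which lower bounds on its [inf] require. Alice, then Bob,
    compares the input with each possible value in turn; no input reaches the final leaf [o0] of
    either list. *)
Lemma exists_zero_error (X Y : finType) (O : eqType) (g : X -> Y -> O) (o0 : O) :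
  exists p : protocol X Y O, wf_protocol p /\ zero_error p g.
Proof.
have bob (h : Y -> O) (s : seq Y) : exists p : protocol X Y O, wf_protocol p /\
    forall x y, y \in s -> ev p x y (fun o _ => (o != h y)%:R) = 0.
  elim: s => [|y0 s [p [wp hp]]]; first by exists (PLeaf X Y o0).
  exists (PBob (fun y => (y == y0)%:R) p (PLeaf X Y (h y0))); split=> /=.
    by split=> // y; case: eqP; rewrite ?lexx ?ler01.
  move=> x y; rewrite inE; case: eqVneq => [-> _|_ /= ys].
    by rewrite eqxx subrr mul0r mulr0 addr0.
  by rewrite mul0r addr0 subr0 mul1r hp.
have alice (s : seq X) : exists p : protocol X Y O, wf_protocol p /\
    forall x y, x \in s -> ev p x y (fun o _ => (o != g x y)%:R) = 0.
  elim: s => [|x0 s [p [wp hp]]]; first by exists (PLeaf X Y o0).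
  have [p' [wp' hp']] := bob (g x0) (enum Y).
  exists (PAlice (fun x => (x == x0)%:R) p p'); split=> /=.
    by split=> // x; case: eqP; rewrite ?lexx ?ler01.
  move=> x y; rewrite inE; case: eqVneq => [-> _|_ /= xs].
    by rewrite subrr mul0r add0r mul1r hp' // mem_enum.
  by rewrite mul0r addr0 subr0 mul1r hp.
have [p [wp hp]] := alice (enum X); exists p; split=> //.
by apply/zero_errorP => x y; rewrite hp ?mem_enum.
Qed.

Lemma CC0_tensor_ge (X Y : finType) (O : eqType) (f : X -> Y -> O) (o0 : O) (mu w : X * Y -> Rl) q :
  is_distr mu -> (forall u, 0 < w u) -> mono_mass_le1 f (fun u => mu u * w u) ->
  q%:R * (\sum_u mu u * ln (w u)) <= ln 2 * CC0 (prod_distr mu q) (tensor_fun f q).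
Proof.
move=> dmu w0 mm; have ln2 : 0 < ln 2 :> Rl by rewrite ln_gt0 // ltr1n.
rewrite -ler_pdivrMl //; apply: lb_le_inf.
  have [p [wp zp]] := exists_zero_error (tensor_fun f q) [tuple o0 | i < q].
  by exists (exp_cost p (prod_distr mu q)), p.
move=> _ [p [wp zp ->]]; rewrite ler_pdivrMl // -sum_prod_distr_ln //.
apply: exp_cost_ge zp _ _ _ => //; first exact: is_distr_prod.
  by move=> z; apply: prodr_gt0.
have [m0 mM] := mono_mass_tensor q mm.
have e z : prod_distr mu q z * prod_distr w q z = prod_distr (fun u => mu u * w u) q z.
  by rewrite /prod_distr -big_split.
split=> [z|A B mAB]; first by rewrite e.
by under eq_bigr do rewrite e; exact: mM.
Qed.

(** * Composition of protocols, subadditivity and existence of the limit *)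

Fixpoint pbind (X Y X1 Y1 : Type) (O O1 : eqType) (fx : X -> X1) (fy : Y -> Y1)
    (p : protocol X1 Y1 O1) (k : O1 -> protocol X Y O) : protocol X Y O :=
  match p with
  | PLeaf o => k o
  | PAlice a p0 p1 => PAlice (fun x => a (fx x)) (pbind fx fy p0 k) (pbind fx fy p1 k)
  | PBob b p0 p1 => PBob (fun y => b (fy y)) (pbind fx fy p0 k) (pbind fx fy p1 k)
  | PPublic r p0 p1 => PPublic r (pbind fx fy p0 k) (pbind fx fy p1 k)
  end.

Lemma wf_pbind (X Y X1 Y1 : Type) (O O1 : eqType) (fx : X -> X1) (fy : Y -> Y1)
    (p : protocol X1 Y1 O1) (k : O1 -> protocol X Y O) :
  wf_protocol p -> (forall o, wf_protocol (k o)) -> wf_protocol (pbind fx fy p k).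
Proof.
move=> wp wk.
elim: p wp => [ou|a p0 IH0 p1 IH1|b p0 IH0 p1 IH1|r p0 IH0 p1 IH1] //= [h [/IH0 w0 /IH1 w1]];
  by split.
Qed.

Lemma ev_pbind (X Y X1 Y1 : Type) (O O1 : eqType) (fx : X -> X1) (fy : Y -> Y1)
    (p : protocol X1 Y1 O1) (k : O1 -> protocol X Y O) x y phi :
  ev (pbind fx fy p k) x y phi =
  ev p (fx x) (fy y) (fun o c => ev (k o) x y (fun o' c' => phi o' (c + c')%N)).
Proof.
elim: p phi => [ou|a p0 IH0 p1 IH1|b p0 IH0 p1 IH1|r p0 IH0 p1 IH1] phi //=;
  by rewrite IH0 IH1.
Qed.

Section Concatenation.
Context {X Y : finType} {O : eqType} (f : X -> Y -> O) (mu : X * Y -> Rl).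
Variables q r : nat.

Let lpart (T : Type) (t : (q + r).-tuple T) := [tuple tnth t (lshift r i) | i < q].
Let rpart (T : Type) (t : (q + r).-tuple T) := [tuple tnth t (rshift q i) | i < r].

Let partK (T : Type) (t : (q + r).-tuple T) : cat_tuple (lpart t) (rpart t) = t.
Proof.
apply: eq_from_tnth => i; case: (split_ordP i) => j ->.
  by rewrite tnth_lshift tnth_mktuple.
by rewrite tnth_rshift tnth_mktuple.
Qed.

Let lpart_cat (T : Type) (a : q.-tuple T) (b : r.-tuple T) : lpart (cat_tuple a b) = a.
Proof. by apply: eq_from_tnth => i; rewrite tnth_mktuple tnth_lshift. Qed.

Let rpart_cat (T : Type) (a : q.-tuple T) (b : r.-tuple T) : rpart (cat_tuple a b) = b.
Proof. by apply: eq_from_tnth => i; rewrite tnth_mktuple tnth_rshift. Qed.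

Let tensor_cat x y : tensor_fun f (q + r) x y =
  cat_tuple (tensor_fun f q (lpart x) (lpart y)) (tensor_fun f r (rpart x) (rpart y)).
Proof.
apply: eq_from_tnth => i; case: (split_ordP i) => j ->.
  by rewrite tnth_lshift !tnth_mktuple.
by rewrite tnth_rshift !tnth_mktuple.
Qed.

Let sum_prod_cat (G : q.-tuple X * q.-tuple Y -> Rl) (H : r.-tuple X * r.-tuple Y -> Rl) :
  is_distr mu ->
  \sum_z prod_distr mu (q + r) z * (G (lpart z.1, lpart z.2) + H (rpart z.1, rpart z.2)) =
  \sum_z prod_distr mu q z * G z + \sum_z prod_distr mu r z * H z.
Proof.
move=> dmu; have [_ m1] := is_distr_prod q dmu; have [_ m2] := is_distr_prod r dmu.
pose h (u : (q.-tuple X * q.-tuple Y) * (r.-tuple X * r.-tuple Y)) :=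
  (cat_tuple u.1.1 u.2.1, cat_tuple u.1.2 u.2.2).
pose h' (z : (q + r).-tuple X * (q + r).-tuple Y) := ((lpart z.1, lpart z.2), (rpart z.1, rpart z.2)).
have hK : cancel h h' by move=> [[a b] [c d]]; rewrite /h /h' /= !lpart_cat !rpart_cat.
have h'K : cancel h' h by move=> [x y]; rewrite /h /h' /= !partK.
rewrite (reindex h) /=; last by apply: onW_bij; exists h'.
rewrite -(pair_bigA _ (fun u v => prod_distr mu (q + r) (h (u, v)) *
  (G (lpart (h (u, v)).1, lpart (h (u, v)).2) + H (rpart (h (u, v)).1, rpart (h (u, v)).2)))) /=.
have e u v : prod_distr mu (q + r) (h (u, v)) = prod_distr mu q u * prod_distr mu r v.
  rewrite /prod_distr big_split_ord /=; congr (_ * _); apply: eq_bigr => i _;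
  by rewrite ?tnth_lshift ?tnth_rshift.
transitivity (\sum_u \sum_v (prod_distr mu q u * G u * prod_distr mu r v +
   prod_distr mu q u * (prod_distr mu r v * H v))).
  apply: eq_bigr => u _; apply: eq_bigr => v _.
  by rewrite e !lpart_cat !rpart_cat -!surjective_pairing; ring.
under [LHS]eq_bigr do rewrite big_split -!mulr_sumr m2 mulr1 /=.
by rewrite big_split -mulr_suml m1 mul1r.
Qed.

(** The two blocks of coordinates are solved one after the other by [pbind]; the costs add up, and
    each block is distributed as a product of copies of [mu]. *)
Lemma CC0_subadd (o0 : O) : is_distr mu ->
  CC0 (prod_distr mu (q + r)) (tensor_fun f (q + r)) <=
  CC0 (prod_distr mu q) (tensor_fun f q) + CC0 (prod_distr mu r) (tensor_fun f r).
Proof.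
move=> dmu.
have ne s : ([set c | exists p : protocol (s.-tuple X) (s.-tuple Y) (s.-tuple O),
    [/\ wf_protocol p, zero_error p (tensor_fun f s) & c = exp_cost p (prod_distr mu s)]] !=set0)%classic.
  have [p [wp zp]] := exists_zero_error (tensor_fun f s) [tuple o0 | i < s].
  by exists (exp_cost p (prod_distr mu s)), p.
have cost0 s (p : protocol (s.-tuple X) (s.-tuple Y) (s.-tuple O)) :
    wf_protocol p -> 0 <= exp_cost p (prod_distr mu s).
  move=> wp; rewrite exp_costE; apply: sumr_ge0 => z _.
  by rewrite mulr_ge0 ?prod_distr_ge0 ?ev_ge0 //; case: dmu.
rewrite -lerBlDr; apply: lb_le_inf; [exact: ne | move=> _ [p [wp /zero_errorP zp ->]]].
rewrite lerBlDr addrC -lerBlDr; apply: lb_le_inf; [exact: ne | move=> _ [p' [wp' /zero_errorP zp' ->]]].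
rewrite lerBlDr addrC.
pose P := pbind (@lpart X) (@lpart Y) p (fun o => pbind (@rpart X) (@rpart Y) p'
   (fun o' => PLeaf _ _ (cat_tuple o o'))).
have evP x y phi : ev P x y phi = ev p (lpart x) (lpart y) (fun o c =>
    ev p' (rpart x) (rpart y) (fun o' c' => phi (cat_tuple o o') (c + c')%N)).
  rewrite ev_pbind; apply: eq_ev => o c; rewrite ev_pbind; apply: eq_ev => o' c' /=.
  by rewrite addn0.
have wP : wf_protocol P by apply: wf_pbind => // o; exact: wf_pbind.
apply: (@le_trans _ _ (exp_cost P (prod_distr mu (q + r)))).
  apply: ge_inf.
    by exists 0 => _ [p0 [w0 _ ->]]; exact: cost0.
  exists P; split=> //; apply/zero_errorP => x y; apply/le_anti.
  rewrite ev_ge0 ?andbT // evP tensor_cat.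
  set g := tensor_fun f q _ _; set g' := tensor_fun f r _ _.
  have e := zp (lpart x) (lpart y); have e' := zp' (rpart x) (rpart y).
  (* Union bound: the concatenated output is wrong only if one of its blocks is. *)
  apply: le_trans (_ : ev p (lpart x) (lpart y) (fun o _ => ev p' (rpart x) (rpart y)
      (fun o' _ => 1 * (o' != g')%:R + (o != g)%:R)) <= _).
    apply: ev_le => // o c; apply: ev_le => // o' c'; rewrite mul1r -natrD ler_nat.
    by case: (eqVneq o g) => [->|_]; case: (eqVneq o' g') => [->|_]; rewrite /= ?eqxx // (leq_trans (leq_b1 _)).
  rewrite -[leRHS]e -/g; apply: ev_le => // o c.
  by rewrite (ev_linear _ _ _ 1 (fun o' _ => (o' != g')%:R) (fun _ _ => (o != g)%:R)) e' mulr0 add0r ev_cst.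
rewrite !exp_costE -sum_prod_cat // le_eqVlt; apply/orP; left; apply/eqP.
apply: eq_bigr => z _; congr (_ * _); rewrite evP /=.
set k := ev p' _ _ (fun _ c => c%:R).
rewrite -(ev_cst p (lpart z.1) (lpart z.2) k) -[X in _ = X + _]mul1r.
rewrite -(ev_linear p _ _ 1 (fun _ c => c%:R)); apply: eq_ev => o c; rewrite mul1r.
rewrite -(ev_cst p' (rpart z.1) (rpart z.2) c%:R) addrC -[X in _ = X + _]mul1r.
rewrite -(ev_linear p' _ _ 1 (fun _ c => c%:R)).
by apply: eq_ev => o' c'; rewrite mul1r natrD addrC.
Qed.
End Concatenation.

(** Fekete's lemma: the limit is the infimum of [u n / n] over positive [n], which is finite as [u]
    is nonnegative. *)
Lemma subadditive_cvg (u : nat -> Rl) :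
  (forall n, 0 <= u n) -> (forall m n, u (m + n)%N <= u m + u n) ->
  cvgn (fun n => u n / n%:R).
Proof.
move=> u0 uD.
pose E : set Rl := [set v | exists2 n, (0 < n)%N & v = u n / n%:R]%classic.
have lbE : has_lbound E by exists 0 => _ [n n0 ->]; rewrite divr_ge0.
have neE : (E !=set0)%classic by exists (u 1%N / 1%:R), 1%N.
apply: (@cvgP _ _ (inf E)); apply/cvgrPdist_le => e e0.
have [_ [q q0 ->] uq] := inf_adherent (divr_gt0 e0 (ltr0n Rl 2)) (conj neE lbE).
have uM k r : u (k * q + r)%N <= k%:R * u q + u r.
  elim: k => [|k IH]; first by rewrite mul0r add0r mul0n.
  by rewrite mulSn -addnA (le_trans (uD _ _)) // -natr1 mulrDl mul1r -addrA addrCA lerD2l.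
(* [M] bounds every remainder term [u r] with [r < q], and is negligible after division by [n]. *)
pose M := \sum_(i < q) u i.
have uM' n : u n <= n%:R * (u q / q%:R) + M.
  rewrite (divn_eq n q) (le_trans (uM _ _)) // lerD //.
    have e' : u q = q%:R * (u q / q%:R) by rewrite mulrC divfK // pnatr_eq0 -lt0n.
    have a0 : 0 <= u q / q%:R by rewrite divr_ge0.
    rewrite natrD natrM mulrDl {1}e' mulrA lerDl.
    by rewrite mulr_ge0.
  have lt := ltn_pmod n q0.
  by rewrite /M (bigD1 (Ordinal lt)) //= lerDl sumr_ge0.
near=> n.
have n0 : (0 < n)%N by near: n; exact: nbhs_infty_ge.
have nR : 0 < n%:R :> Rl by rewrite ltr0n.
have le1 : inf E <= u n / n%:R by apply: ge_inf => //; exists n.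
rewrite distrC ger0_norm ?subr_ge0 // lerBlDr.
have Mn : M <= e / 2 * n%:R.
  rewrite -ler_pdivrMl ?divr_gt0 //.
  apply: (@le_trans _ _ (Num.truncn ((e / 2)^-1 * M)).+1%:R).
    by rewrite ltW // truncnS_gt.
  by rewrite ler_nat; near: n; exact: nbhs_infty_ge.
rewrite ler_pdivrMr //; apply: (le_trans (uM' n)).
have : n%:R * (u q / q%:R) <= n%:R * (inf E + e / 2) by rewrite ler_pM2l // ltW.
rewrite mulrDr; lra.
Unshelve. all: by end_near.
Qed.

Lemma CC0_ge0 (X Y : finType) (O : eqType) (g : X -> Y -> O) nu : is_distr nu -> 0 <= CC0 nu g.
Proof.
move=> [nu0 _]; rewrite /CC0; set E := (X in inf X).
have [[v Ev]|nE] := pselect (E !=set0)%classic; last first.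
  by rewrite inf_out // => -[].
apply: lb_le_inf; first by exists v.
move=> _ [p [wp _ ->]]; rewrite exp_costE; apply: sumr_ge0 => z _.
by rewrite mulr_ge0 ?ev_ge0.
Qed.

(** The bound for each [q] passes to the limit once convergence is known; for a divergent sequence
    [limn] would be a meaningless default. *)
Lemma lim_CC0_ge (X Y : finType) (O : eqType) (f : X -> Y -> O) (o0 : O) (mu w : X * Y -> Rl) :
  is_distr mu -> (forall u, 0 < w u) -> mono_mass_le1 f (fun u => mu u * w u) ->
  \sum_u mu u * ln (w u) <=
  ln 2 * limn (fun q : nat => CC0 (prod_distr mu q) (tensor_fun f q) / q%:R).
Proof.
move=> dmu w0 mm; have ln2 : 0 < ln 2 :> Rl by rewrite ln_gt0 // ltr1n.
rewrite mulrC -ler_pdivrMr //; apply: limr_ge.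
  apply: subadditive_cvg => [q|q r]; first by apply: CC0_ge0; exact: is_distr_prod.
  exact: CC0_subadd.
near=> q.
have q0 : (0 < q)%N by near: q; exact: nbhs_infty_ge.
rewrite ler_pdivlMr ?ltr0n // mulrAC ler_pdivrMr // mulrC [leRHS]mulrC.
exact: CC0_tensor_ge.
Unshelve. all: by end_near.
Qed.

(** * Greedy covers and protocols built from covers *)

Definition covered (X Y : finType) (l : seq ({set X} * {set Y})) (z : X * Y) : bool :=
  has (fun S => rect S.1 S.2 z) l.

(** Each step takes a rectangle of largest uncovered mass. The gains never increase, and every
    remaining uncovered mass is at most the last gain, so [k] times it is at most the sum of the
    gains, which is the covered mass. *)
Lemma greedy_cover (X Y : finType) (f : X -> Y -> bool) (mu : X * Y -> Rl) k :
  (forall z, 0 <= mu z) ->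
  exists l : seq ({set X} * {set Y}),
    [/\ size l = k, forall S, S \in l -> mono f S.1 S.2 &
     forall A B, mono f A B ->
       k%:R * \sum_(z | rect A B z && ~~ covered l z) mu z <= \sum_(z | covered l z) mu z].
Proof.
move=> mu0; elim: k => [|k [l [sl ml hl]]].
  by exists [::]; split=> // A B _; rewrite mul0r sumr_ge0.
pose F (S : {set X} * {set Y}) := \sum_(z | rect S.1 S.2 z && ~~ covered l z) mu z.
pose P : pred ({set X} * {set Y}) := fun S => `[< mono f S.1 S.2 >].
(* The empty rectangle ensures that the maximum is over a nonempty family. *)
have P0 : P (finset.set0, finset.set0) by apply/asboolP; exists true => x y; rewrite inE.
have [S0 /asboolP mS0 maxS0] := arg_maxP F P0.
exists (S0 :: l); split=> [|S|A B mAB]; first by rewrite /= sl.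
  by rewrite inE => /predU1P[->|/ml].
have -> : \sum_(z | covered (S0 :: l) z) mu z = \sum_(z | covered l z) mu z + F S0.
  rewrite (bigID (covered l)) /=; congr (_ + _); apply: eq_bigl => z.
    by rewrite /covered /=; case: (has _ l); rewrite ?andbF ?orbT.
  by rewrite /covered /=; case: (has _ l); rewrite ?andbF ?orbF.
have leF : \sum_(z | rect A B z && ~~ covered (S0 :: l) z) mu z <= F S0.
  have := maxS0 (A, B) (introT (asboolP _) mAB); apply: le_trans.
  rewrite /F /= [leLHS]big_mkcond [leRHS]big_mkcond; apply: ler_sum => z _.
  rewrite /covered /=; case: (rect A B z) => //=; case: (has _ l); rewrite /= ?orbT ?orbF //.
  by case: ifP.
by rewrite -natr1 mulrDl mul1r lerD // (le_trans _ (hl _ _ mS0)) // ler_wpM2l.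
Qed.

(* A rectangle of F cannot meet both a row and a column of a rectangle of G, so
   its rows or its columns meet at most half of G.  A player announcing that the
   input lies in those rows (columns) halves the candidates in G. *)
Lemma halving_protocol (X Y : finType) (F G : seq ({set X} * {set Y})) j :
  (size G < 2 ^ j)%N ->
  (forall z, covered G z -> covered F z -> False) ->
  exists p : protocol X Y bool,
    [/\ wf_protocol p, (size (leaves p) <= (size F).+1 ^ j)%N,
      forall z, covered G z -> ev p z.1 z.2 (fun o _ => o%:R) = 0 &
      forall z, covered F z -> ev p z.1 z.2 (fun o _ => (~~ o)%:R) = 0].
Proof.
elim: j G => [|j IH] G.
  by case: G => // _ _; exists (PLeaf X Y true).
move=> sG dis.
have sub_cov (H G' : seq ({set X} * {set Y})) z : {subset H <= G'} -> covered H z -> covered G' z.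
  by move=> s /hasP[S /s SG' Sz]; apply/hasP; exists S.
suff [p [wp sp pG pF]] : exists p : protocol X Y bool,
    [/\ wf_protocol p, (size (leaves p) <= 1 + size F * (size F).+1 ^ j)%N,
      forall z, covered G z -> ev p z.1 z.2 (fun o _ => o%:R) = 0 &
      forall z, covered F z -> ev p z.1 z.2 (fun o _ => (~~ o)%:R) = 0].
  exists p; split=> //; apply: (leq_trans sp).
  by rewrite expnS mulSn leq_add2r expn_gt0.
(* The inner induction is on the list of rectangles of [F] still to be tested, with the base
   [(size F).+1] kept fixed. A positive test recurses with half of [G]; when all tests fail, the
   answer is [false]. *)
have : {subset F <= F} by [].
elim: {1 3 5}F => [|T L IHL] sL.
  exists (PLeaf X Y false); split=> //.
have [|p [wp sp pG pL]] := IHL; first by move=> S SL; apply: sL; rewrite inE SL orbT.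
have TF : T \in F by apply: sL; rewrite inE eqxx.
pose GA := [seq S <- G | S.1 :&: T.1 != finset.set0].
pose GB := [seq S <- G | S.2 :&: T.2 != finset.set0].
have sAB : (size GA + size GB <= size G)%N.
  have d S : S \in G -> ~~ ((S.1 :&: T.1 != finset.set0) && (S.2 :&: T.2 != finset.set0)).
    move=> SG; apply/negP => /andP[/finset.set0Pn[x /finset.setIP[x1 x2]] /finset.set0Pn[y /finset.setIP[y1 y2]]].
    by apply: (dis (x, y)); apply/hasP; [exists S | exists T] => //; apply/andP.
  (* By inclusion-exclusion: no rectangle of [G] lies in both [GA] and [GB]. *)
  rewrite !size_filter -count_predUI [X in (_ + X)%N](_ : _ = 0%N) ?addn0 ?count_size //.
  by apply/eqP; rewrite -leqn0 leqNgt -has_count; apply/hasPn => S SG; exact: d.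
have GAG : {subset GA <= G} by move=> S; rewrite mem_filter => /andP[].
have GBG : {subset GB <= G} by move=> S; rewrite mem_filter => /andP[].
have half (H : seq ({set X} * {set Y})) : {subset H <= G} -> (2 * size H <= size G)%N ->
   exists p : protocol X Y bool,
    [/\ wf_protocol p, (size (leaves p) <= (size F).+1 ^ j)%N,
      forall z, covered H z -> ev p z.1 z.2 (fun o _ => o%:R) = 0 &
      forall z, covered F z -> ev p z.1 z.2 (fun o _ => (~~ o)%:R) = 0].
  move=> HG sH; apply: IH => [|z /(sub_cov _ _ _ HG)]; last exact: dis.
  by rewrite -(ltn_pmul2l (isT : 0 < 2)%N) -expnS (leq_ltn_trans sH).
have szn (p' : protocol X Y bool) : (size (leaves p') <= (size F).+1 ^ j)%N ->
    (size (leaves p) + size (leaves p') <= 1 + size (T :: L) * (size F).+1 ^ j)%N.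
  by move=> sp'; rewrite /= mulSn addnCA addnC leq_add.
have [hA|hB] : (2 * size GA <= size G \/ 2 * size GB <= size G)%N by lia.
  have [p' [wp' sp' pG' pF']] := half GA GAG hA.
  exists (PAlice (fun x => (x \in T.1)%:R) p p'); split=> /=.
  - by split=> // x; case: (x \in _); rewrite ?lexx ?ler01.
  - by rewrite size_cat !size_map szn.
  - move=> [x y] /= cG; rewrite (pG (x, y)) // mulr0 add0r.
    case: (boolP (x \in T.1)) => xT; last by rewrite mul0r.
    rewrite (pG' (x, y)) ?mulr0 //; case/hasP: cG => S SG /andP[/= Sx Sy].
    apply/hasP; exists S; last exact/andP.
    by rewrite mem_filter SG andbT; apply/finset.set0Pn; exists x; rewrite inE Sx.
  - move=> [x y] cL; have cF := sub_cov _ _ _ sL cL; rewrite /=.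
    rewrite (pF' (x, y)) // mulr0 addr0.
    case: (boolP (x \in T.1)) => xT; first by rewrite subrr mul0r.
    rewrite (pL (x, y)) ?mulr0 //; case/orP: cL => // /andP[/= xT' _].
    by rewrite xT' in xT.
have [p' [wp' sp' pG' pF']] := half GB GBG hB.
exists (PBob (fun y => (y \in T.2)%:R) p p'); split=> /=.
- by split=> // y; case: (y \in _); rewrite ?lexx ?ler01.
- by rewrite size_cat !size_map szn.
- move=> [x y] /= cG; rewrite (pG (x, y)) // mulr0 add0r.
  case: (boolP (y \in T.2)) => yT; last by rewrite mul0r.
  rewrite (pG' (x, y)) ?mulr0 //; case/hasP: cG => S SG /andP[/= Sx Sy].
  apply/hasP; exists S; last exact/andP.
  by rewrite mem_filter SG andbT; apply/finset.set0Pn; exists y; rewrite inE Sy.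
- move=> [x y] cL; have cF := sub_cov _ _ _ sL cL; rewrite /=.
  rewrite (pF' (x, y)) // mulr0 addr0.
  case: (boolP (y \in T.2)) => yT; first by rewrite subrr mul0r.
  rewrite (pL (x, y)) ?mulr0 //; case/orP: cL => // /andP[_ /= yT'].
  by rewrite yT' in yT.
Qed.

Lemma errE (X Y : finType) (O : eqType) (p : protocol X Y O) nu (g : X -> Y -> O) :
  err p nu g = \sum_z nu z * ev p z.1 z.2 (fun o _ => (o != g z.1 z.2)%:R).
Proof.
apply: eq_bigr => z _; congr (_ * _); rewrite big_mkcond /=.
under eq_bigr => t _ do rewrite -mulrb -mulr_natr.
by rewrite (sum_leavesE p z.1 z.2 (fun o _ => (o != Some (g z.1 z.2))%:R)).
Qed.

(* [inf] is 0 on a set that is not bounded below, whence the hypothesis 0 <= c. *)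
Lemma IC_ext_le (X Y : finType) (O : eqType) (p : protocol X Y O) nu g eps c :
  wf_protocol p -> err p nu g <= eps -> ext_info p nu <= c -> 0 <= c -> IC_ext nu g eps <= c.
Proof.
move=> wp ep ip c0; rewrite /IC_ext; set E := (X in inf X).
have [hE|nE] := pselect (has_lbound E).
  by apply: le_trans ip; apply: ge_inf => //; exists p.
by rewrite inf_out // => -[].
Qed.

Lemma cover_protocol (X Y : finType) (f : X -> Y -> bool) (l : seq ({set X} * {set Y})) m :
  (forall S, S \in l -> mono f S.1 S.2) -> (size l <= 2 ^ m)%N ->
  exists p : protocol X Y bool,
    [/\ wf_protocol p, (size (leaves p) <= 2 ^ (m.+1 ^ 2))%N &
      forall z, covered l z -> ev p z.1 z.2 (fun o _ => (o != f z.1 z.2)%:R) = 0].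
Proof.
move=> ml sl.
pose Fv v := [seq S : {set X} * {set Y} <- l | `[< forall x y, x \in S.1 -> y \in S.2 -> f x y = v >]].
have Fval v z : covered (Fv v) z -> f z.1 z.2 = v.
  by case/hasP => S; rewrite mem_filter => /andP[/asboolP h _] /andP[]; exact: h.
have sF v : (size (Fv v) <= 2 ^ m)%N by rewrite size_filter (leq_trans (count_size _ _)).
(* The exponent is [m.+1] because the size must be strictly below the power of 2; then
   [(2^m + 1)^(m+1) <= 2^((m+1)^2)] leaves suffice. *)
have [||p [wp sp p0 p1]] := @halving_protocol X Y (Fv true) (Fv false) m.+1.
- by rewrite (leq_ltn_trans (sF _)) // ltn_exp2l.
- by move=> z /Fval h /Fval; rewrite h.
exists p; split=> //.
  rewrite (leq_trans sp) // -mulnn expnM leq_exp2r // expnS mul2n -addnn -addn1.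
  by rewrite leq_add // expn_gt0.
move=> z /hasP[S Sl Sz]; have [v hv] := ml S Sl.
have cv : covered (Fv v) z.
  by apply/hasP; exists S => //; rewrite mem_filter Sl andbT; apply/asboolP.
rewrite (Fval v z cv); case: v {hv} cv => cv.
  by rewrite -[RHS](p1 z cv); apply: eq_ev => -[].
by rewrite -[RHS](p0 z cv); apply: eq_ev => -[].
Qed.

(** * From the limit to the external information *)

Section UpperBound.
Context {X Y : finType} (f : X -> Y -> bool) (mu : X * Y -> Rl) (eps : Rl).
Hypotheses (dmu : is_distr mu) (eps0 : 0 < eps).

Let l : Rl := limn (fun q : nat => CC0 (prod_distr mu q) (tensor_fun f q) / q%:R).

Let l_ge (w : X * Y -> Rl) : (forall u, 0 < w u) -> mono_mass_le1 f (fun u => mu u * w u) ->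
  \sum_u mu u * ln (w u) <= ln 2 * l.
Proof. by move=> w0 mw; apply: lim_CC0_ge => //; exact: true. Qed.

Let mass v : Rl := \sum_(z | f z.1 z.2 == v) mu z.

Let mass_split : mass true + mass false = 1.
Proof.
case: dmu => _ <-; rewrite (bigID (fun z => f z.1 z.2 == true)) /=; congr (_ + _).
by apply: eq_bigl => z; case: (f _ _).
Qed.

(** The constant output [~~ v] errs exactly where [f] equals [v], and a single leaf reveals
    nothing. *)
Lemma IC_const v : mass v <= eps -> IC_ext mu f eps <= 0.
Proof.
move=> mv; apply: (@IC_ext_le _ _ _ (PLeaf X Y (~~ v))) => //.
  apply: le_trans mv; rewrite errE /mass [leRHS]big_mkcond; apply: ler_sum => z _ /=.
  by case: (f _ _); case: v; rewrite /= ?mulr1 ?mulr0.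
by have := @ext_info_le_leaves _ _ _ (PLeaf X Y (~~ v)) mu I dmu; rewrite /= ln1 mul0r.
Qed.

Hypothesis balanced : forall v, eps < mass v.

Let mass_gt0 v : 0 < mass v.
Proof. exact: lt_trans (balanced v). Qed.

(** The left-hand side is the entropy of the value of [f], in nats. A rectangle of value [v] lies in
    the set where [f] equals [v], so weight [1 / mass v] gives it mass at most 1. *)
Lemma entropy_le : \sum_(v : bool) mass v * ln (mass v)^-1 <= ln 2 * l.
Proof.
apply: le_trans (l_ge (w := fun z => (mass (f z.1 z.2))^-1) _ _).
- rewrite (partition_big (fun z => f z.1 z.2) xpredT) //= ler_sum // => v _.
  by rewrite mulr_suml ler_sum // => z /eqP ->.
- by move=> u; rewrite invr_gt0.
split=> [z|A B [v fv]]; first by rewrite mulr_ge0 ?invr_ge0 ?(ltW (mass_gt0 _)) //; case: dmu.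
apply: le_trans (_ : mass v / mass v <= _); last by rewrite divff // gt_eqF.
rewrite mulr_suml big_mkcond [leRHS]big_mkcond; apply: ler_sum => z _.
case: ifP => [/andP[zA zB]|_]; first by rewrite (fv _ _ zA zB) eqxx.
by case: ifP => // _; rewrite mulr_ge0 ?invr_ge0 ?(ltW (mass_gt0 _)) //; case: dmu.
Qed.

Lemma eps_bounds : [/\ eps < 1 / 2, eps <= ln 2 * l & eps * ln eps^-1 <= 2 * (ln 2 * l)].
Proof.
have e0 := eps0.
have [v v2] : exists v, mass v <= 1 / 2.
  have [t2|t2] := leP (mass true) (1 / 2); first by exists true.
  by exists false; have := mass_split; lra.
have bv := balanced v; have p0 := mass_gt0 v.
have q0 := mass_gt0 (~~ v).
have e : mass v + mass (~~ v) = 1 by case: (v); rewrite // addrC.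
have H : mass v * ln (mass v)^-1 + mass (~~ v) * ln (mass (~~ v))^-1 <= ln 2 * l.
  apply: le_trans entropy_le; rewrite big_bool /=.
  by case: (v) => //=; rewrite addrC.
have lnge u : 0 < u -> 1 - u <= ln u^-1 :> Rl.
  by move=> u0; rewrite lnV ?posrE //; have := ln_le_subr1 u0; lra.
have h1 := lnge _ p0; have h2 := lnge _ q0.
have a1 : mass v * (1 - mass v) <= mass v * ln (mass v)^-1 by rewrite ler_pM2l.
have a2 : mass (~~ v) * (1 - mass (~~ v)) <= mass (~~ v) * ln (mass (~~ v))^-1 by rewrite ler_pM2l.
(* With [p = mass v <= 1/2], the entropy is at least [2 p (1 - p) >= p]. *)
have pl : mass v <= ln 2 * l by nra.
split; [lra | lra |].
(* Multiplied by [eps < p], this gives [eps ln(1/eps) <= p ln(1/p) + p], and each of the two terms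
   is at most [ln 2 * l]. *)
have : ln eps^-1 <= ln (mass v)^-1 + (mass v / eps - 1).
  rewrite [in leLHS](_ : eps^-1 = (mass v)^-1 * (mass v / eps)); last by rewrite mulKf // gt_eqF.
  by rewrite lnM ?posrE ?invr_gt0 ?divr_gt0 // lerD2l ln_le_subr1 // divr_gt0 //.
rewrite -(ler_pM2l eps0) => h.
have e1 : eps * (mass v / eps) = mass v by rewrite mulrC divfK // gt_eqF.
have lv : 0 <= ln (mass v)^-1 by apply: le_trans h1; lra.
have b : eps * ln (mass v)^-1 <= mass v * ln (mass v)^-1 by rewrite ler_wpM2r // ltW.
have q2 : 0 <= mass (~~ v) * ln (mass (~~ v))^-1 by apply: le_trans a2; rewrite mulr_ge0 ?(ltW q0) //; lra.
move: h; rewrite mulrDr mulrBr e1 mulr1 => h; lra.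
Qed.

Lemma uncovered_le m (L : seq ({set X} * {set Y})) : (forall S, S \in L -> mono f S.1 S.2) ->
  (forall A B, mono f A B ->
     (2 ^ m)%:R * \sum_(z | rect A B z && ~~ covered L z) mu z <= \sum_(z | covered L z) mu z) ->
  5 * l < eps * m%:R -> \sum_(z | ~~ covered L z) mu z <= eps.
Proof.
move=> mL hL lm; rewrite leNgt; apply/negP => nu_gt.
have [mu0 mu1] := dmu.
have ln2 : 0 < ln 2 :> Rl by rewrite ln_gt0 // ltr1n.
have [e2 el eln] := eps_bounds; have e0 := eps0.
pose k : Rl := (2 ^ m)%:R.
have k0 : 0 < k by rewrite ltr0n expn_gt0.
have lnk : ln k = m%:R * ln 2 by rewrite /k natrX lnXn // mulr_natl.
(* In a monochromatic rectangle the covered part gets mass at most [1 - eps], and the uncovered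
   part, of [mu]-mass at most [1/k], gets at most [eps]. *)
pose w z := if covered L z then 1 - eps else k * eps.
have w0 z : 0 < w z by rewrite /w; case: ifP => _; [lra | rewrite mulr_gt0].
have klarge : 5 * (ln 2 * l) < eps * ln k by rewrite lnk; nra.
(* This sign allows the uncovered mass to be replaced by the smaller [eps] in [b2]. *)
have keps : 0 <= ln (k * eps).
  rewrite lnM ?posrE // -[ln eps]opprK -lnV ?posrE // subr_ge0 -(ler_pM2l eps0); lra.
have l1e : - (2 * eps) <= ln (1 - eps).
  rewrite -[ln _]opprK -lnV ?posrE ?subr_gt0; last lra.
  rewrite lerN2 (le_trans (ln_le_subr1 _)) ?invr_gt0 ?subr_gt0 //; try lra.
  rewrite lerBlDr -[_^-1]mul1r ler_pdivrMr; [nra | lra].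
pose nu : Rl := \sum_(z | ~~ covered L z) mu z.
pose nu' : Rl := \sum_(z | covered L z) mu z.
have nu'0 : 0 <= nu' by apply: sumr_ge0.
have nu0 : 0 <= nu by apply: sumr_ge0.
have nus : nu' + nu = 1 by rewrite -mu1 [RHS](bigID (covered L)).
have mw : mono_mass_le1 f (fun u => mu u * w u).
  split=> [z|A B mAB]; first by rewrite mulr_ge0 // ltW.
  rewrite (bigID (covered L)) /=.
  have S1 : \sum_(z | rect A B z && covered L z) mu z * w z <= 1 - eps.
    apply: le_trans (_ : \sum_(z | covered L z) mu z * (1 - eps) <= _).
      rewrite big_mkcond [leRHS]big_mkcond; apply: ler_sum => z _ /=; rewrite /w.
      by case: (covered L z); rewrite ?andbT ?andbF //; case: (rect A B z) => //; rewrite mulr_ge0 //; lra.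
    by rewrite -mulr_suml -/nu' -[leRHS]mul1r ler_wpM2r //; lra.
  have S2 : \sum_(z | rect A B z && ~~ covered L z) mu z * w z <= eps.
    have -> : \sum_(z | rect A B z && ~~ covered L z) mu z * w z =
        (k * \sum_(z | rect A B z && ~~ covered L z) mu z) * eps.
      rewrite mulrAC mulrC mulr_suml; apply: eq_bigr => z /andP[_ /negPf c].
      by rewrite /w c.
    rewrite -[leRHS]mul1r ler_wpM2r //; first exact: ltW.
    by apply: le_trans (hL A B mAB) _; rewrite -/nu'; lra.
  lra.
(* The bound becomes [eps ln k <= ln 2 * l + 2 eps + eps ln(1/eps)], at most [5 ln 2 * l] by
   [eps_bounds], which contradicts [klarge]. *)
have := l_ge w0 mw.
have -> : \sum_u mu u * ln (w u) = nu' * ln (1 - eps) + nu * ln (k * eps).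
  rewrite (bigID (covered L)) /= /nu' /nu !mulr_suml; congr (_ + _); apply: eq_bigr => z c.
    by rewrite /w c.
  by rewrite /w (negPf c).
have b1 : - (2 * eps) <= nu' * ln (1 - eps) by nra.
have b2 : eps * ln (k * eps) <= nu * ln (k * eps) by rewrite ler_wpM2r // ltW.
have b3 : eps * ln (k * eps) = eps * ln k - eps * ln eps^-1.
  by rewrite lnM ?posrE // lnV ?posrE //; ring.
lra.
Qed.

Lemma IC_balanced : IC_ext mu f eps <= 49 / eps ^+ 2 * l ^+ 2.
Proof.
have [e2 el eln] := eps_bounds; have e0 := eps0.
have ln2 : 0 < ln 2 :> Rl by rewrite ln_gt0 // ltr1n.
have ln21 : ln 2 <= 1 :> Rl by have := @ln_le_subr1 Rl 2 ltac:(by []); lra.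
have l0 : 0 < l by rewrite -(pmulr_rgt0 _ ln2); lra.
have ll : eps <= l by apply: le_trans el _; rewrite ler_piMl // ltW.
pose a : Rl := l / eps.
have ae : a * eps = l by rewrite divfK // gt_eqF.
have a1 : 1 <= a by rewrite ler_pdivlMr // mul1r.
have := Num.Theory.truncn_itv (_ : 0 <= 5 * a); rewrite mulr_ge0 // ?(le_trans ler01 a1) //.
(* Now [m > 5 a], as [uncovered_le] requires, and [m + 1 <= 5 a + 2 <= 7 a] because [a >= 1]. The
   information is at most [(m + 1)^2], whence the constant 49. *)
move=> /(_ isT) /andP[t1 t2]; set m := (Num.truncn (5 * a)).+1 in t2.
have [L [sL mL hL]] := @greedy_cover _ _ f mu (2 ^ m) (proj1 dmu).
have [|p [wp sp pc]] := @cover_protocol _ _ f L m mL; first by rewrite sL.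
have -> : 49 / eps ^+ 2 * l ^+ 2 = 49 * a ^+ 2 by rewrite -ae; field; rewrite gt_eqF.
apply: (IC_ext_le wp).
- apply: le_trans (_ : \sum_(z | ~~ covered L z) mu z <= _).
    rewrite errE [leRHS]big_mkcond; apply: ler_sum => z _ /=.
    case: (boolP (covered L z)) => [/pc ->|_]; first by rewrite mulr0.
    rewrite -[leRHS]mulr1 ler_wpM2l ?(proj1 dmu) // -[leRHS](ev_cst p z.1 z.2 1).
    by apply: ev_le => // o _; rewrite lern1 leq_b1.
  by apply: uncovered_le mL hL _; nra.
- apply: (le_trans (ext_info_le_leaves wp dmu)); rewrite ler_pdivrMr //.
  apply: le_trans (_ : ln (2 ^ (m.+1 ^ 2))%:R <= _).
    by rewrite ler_ln ?posrE ?ltr0n ?expn_gt0 ?size_leaves_gt0 // ler_nat.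
  rewrite natrX lnXn // -[leLHS]mulr_natl ler_wpM2r ?(ltW ln2) // natrX.
  have mr : m.+1%:R <= 7 * a by rewrite /m -[X in X <= _]natr1 -[X in X + _ <= _]natr1; lra.
  have m0 : 0 <= m.+1%:R :> Rl by [].
  nra.
- by rewrite mulr_ge0 // sqr_ge0.
Qed.
End UpperBound.

Lemma IC_ext_le_sqr_lim (X Y : finType) (f : X -> Y -> bool) (mu : X * Y -> Rl) (eps : Rl) :
  is_distr mu -> 0 < eps ->
  IC_ext mu f eps <= 49 / eps ^+ 2 *
    (limn (fun q : nat => CC0 (prod_distr mu q) (tensor_fun f q) / q%:R)) ^+ 2.
Proof.
move=> dmu eps0.
have [h|/existsNP[v /negP]] := pselect (forall v, eps < \sum_(z | f z.1 z.2 == v) mu z).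
  exact: IC_balanced.
rewrite -leNgt => /(IC_const dmu) h; apply: (le_trans h).
by rewrite mulr_ge0 ?sqr_ge0 // divr_ge0 ?sqr_ge0.
Qed.

Theorem theorem1p5 :
  exists C : Rl, 0 < C /\
    forall (eps : Rl), 0 < eps ->
    forall (n : nat) (f : n.-tuple bool -> n.-tuple bool -> bool)
           (mu : n.-tuple bool * n.-tuple bool -> Rl),
      is_distr mu ->
      IC_ext mu f eps <=
        C / eps ^+ 2 *
        (limn (fun q : nat => CC0 (prod_distr mu q) (tensor_fun f q) / q%:R)) ^+ 2.
Proof.
by exists 49; split=> // eps eps0 n f mu dmu; exact: IC_ext_le_sqr_lim.
Qed.
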